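(* Let $\mathcal{P}$ be a $\mathrm{QCLP}(\mathcal{D},\mathcal{C})$-program and $A$ an atom, such that $\mathit{qVal}$ and $\mathit{qBound}$ do not occur in $\mathcal{P}$ or $A$. Let $\Pi$ be a satisfiable finite set of $\mathcal{C}$-constraints and $d\in D\setminus\{\bot\}$ such that $\overline{(A\#d\Leftarrow\Pi)}=(A'\Leftarrow\Pi,\Omega)$. Then the following are equivalent: (1) $\mathcal{P}\vdash_{\mathrm{QCHL}(\mathcal{D},\mathcal{C})}A\#d\Leftarrow\Pi$; (2) $\mathrm{elim}_{\mathcal{D}}(\mathcal{P})\vdash_{\mathrm{CHL}(\mathcal{C})}A'\rho\Leftarrow\Pi$ for some $\rho\in\mathrm{Sol}_{\mathcal{C}}(\Omega)$ with $\mathrm{dom}(\rho)=\mathrm{var}(\Omega)$.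
   Context: $\mathcal{D}=\langle D,\sqsubseteq,\bot,\top,\circ\rangle$ is a qualification domain (lattice with meet $\sqcap$; attenuation $\circ$ associative, commutative, monotonic, $d\circ\top=d$, $d\circ\bot=\bot$, $d\circ e\sqsubseteq e$, distributing over $\sqcap$) existentially expressible in the constraint domain $\mathcal{C}$: there is an injective $\imath:D\setminus\{\bot\}\to C$ and existential $\mathcal{C}$-constraints $\mathrm{qval}(X)=\exists U_1\ldots\exists U_k(B_1\wedge\cdots\wedge B_m)$ whose solutions are exactly the valuations with $X\eta\in\mathrm{ran}(\imath)$, and $\mathrm{qbound}(X,Y,Z)=\exists V_1\ldots\exists V_l(C_1\wedge\cdots\wedge C_q)$ such that for $\eta(X)=\imath(x)$, $\eta(Y)=\imath(y)$, $\eta(Z)=\imath(z)$, $\eta$ solves it iff $x\sqsubseteq y\circ z$. $E_{\mathcal{D}}$ is the CLP program $\mathit{qVal}(X)\gets B_1,\dots,B_m$ and $\mathit{qBound}(X,Y,Z)\gets C_1,\dots,C_q$ (fresh predicates). $\mathrm{Sol}_{\mathcal{C}}(\Omega)$ is the set of valuations satisfying $\Omega$; $\Pi\models_{\mathcal{C}}\pi$ iff every solution of $\Pi$ solves $\pi$. $\mathrm{QCHL}(\mathcal{D},\mathcal{C})$: QDA: from $(t'_i==t_i\theta)\#d_i\Leftarrow\Pi$ ($i=1..n$) and $B_j\theta\#e_j\Leftarrow\Pi$ ($j=1..m$) infer $p(t'_1,\dots,t'_n)\#d\Leftarrow\Pi$ if $p(t_1,\dots,t_n)\xleftarrow{\alpha}B_1\#w_1,\dots,B_m\#w_m\in\mathcal{P}$,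 $e_j\sqsupseteq^?w_j$ ($\sqsupseteq$ if $w_j\ne ?$, true otherwise) and $d\sqsubseteq d_1\sqcap\cdots\sqcap d_n\sqcap\alpha\circ(e_1\sqcap\cdots\sqcap e_m)$; QEA: $(t==s)\#d\Leftarrow\Pi$ if $\Pi\models_{\mathcal{C}}t==s$; QPA: $\kappa\#d\Leftarrow\Pi$ if $\Pi\models_{\mathcal{C}}\kappa$. $\mathrm{CHL}(\mathcal{C})$ (for CLP programs with clauses $p(t_1,\dots,t_n)\gets B_1,\dots,B_m$ and atoms $A\Leftarrow\Pi$): DA: from $(t'_i==t_i\theta)\Leftarrow\Pi$ and $B_j\theta\Leftarrow\Pi$ infer $p(t'_1,\dots,t'_n)\Leftarrow\Pi$; EA: $(t==s)\Leftarrow\Pi$ if $\Pi\models_{\mathcal{C}}t==s$; PA: $\kappa\Leftarrow\Pi$ if $\Pi\models_{\mathcal{C}}\kappa$. Transformation rules (each $p$ of arity $n$ becomes a distinct $p'$ of arity $n+1$): $\overline{t==s}=(t==s,\imath(\top))$; $\overline{\kappa}=(\kappa,\imath(\top))$ for primitive $\kappa$; $\overline{p(t_1,\dots,t_n)}=(p'(t_1,\dots,t_n,W),W)$ with $W$ fresh; if $\overline{A}=(A',w)$ then $\overline{(A\#d\Leftarrow\Pi)}=(A'\Leftarrow\Pi,\{\mathrm{qval}(w),\mathrm{qbound}(\imath(d),\imath(\top),w)\})$. For $C:p(t_1,\dots,t_n)\xleftarrow{\alpha}B_1\#w_1,\dots,B_m\#w_m$ with $\overline{B_j}=(B'_j,w'_j)$,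 $\overline{C}$ is $p'(t_1,\dots,t_n,W)\gets\mathit{qVal}(W),(\mathit{qVal}(w'_j),[w'_j\sqsupseteq^?\imath(w_j)],\mathit{qBound}(W,\imath(\alpha),w'_j),B'_j)_{j=1..m}$ with $W$ fresh, where $[w'_j\sqsupseteq^?\imath(w_j)]$ is omitted if $w_j=?$ and otherwise is $\mathit{qBound}(\imath(w_j),\imath(\top),w'_j)$. $\mathrm{elim}_{\mathcal{D}}(\mathcal{P})=E_{\mathcal{D}}\cup\{\overline{C}\mid C\in\mathcal{P}\}$.
   Formalization: For clauses with empty body (m = 0) and α ≠ ⊤, the transformed clause gets the extra body atom qBound(W, ι(α), ι(⊤)); without it the equivalence fails, e.g. for the fact p with α = 0.5 and d = 1 over [0,1] with product. *)

(* Defs.v *)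
From Stdlib Require List.
From mathcomp Require Import all_boot all_order.

Set Implicit Arguments.
Unset Strict Implicit.
Unset Printing Implicit Defensive.

Local Open Scope order_scope.

(** * Terms, atoms and substitutions *)

(* Data constructors, defined predicates and primitive predicates are ranked
   by arity; [bval] is the set of basic values of the constraint domain. *)
Record signature := Signature {
  dcon : nat -> Type;
  dpred : nat -> Type;
  ppred : nat -> Type;
  bval : Type
}.

Definition var : Type := nat.

(* Parametrised by the type of variables: [term S var] are the terms, and
   [term S void] the ground terms. *)
Inductive term (S : signature) (V : Type) : Type :=
| TVar of V
| TBas of bval S
| TCon (n : nat) of dcon S n & {ffun 'I_n -> term S V}.

Arguments TVar {S V} _.
Arguments TBas {S V} _.
Arguments TCon {S V n} _ _.

Fixpoint bind (S : signature) (V W : Type) (s : V -> term S W)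
    (t : term S V) : term S W :=
  match t with
  | TVar x => s x
  | TBas u => TBas u
  | TCon n c args => TCon c [ffun i => bind s (args i)]
  end.

Fixpoint tvar (S : signature) (V : Type) (x : V) (t : term S V) : Prop :=
  match t with
  | TVar y => x = y
  | TBas _ => False
  | TCon n c args => exists i, tvar x (args i)
  end.

(* The carrier of every constraint domain over [S]. *)
Definition gterm (S : signature) : Type := term S void.

Definition of_gterm (S : signature) (g : gterm S) : term S var :=
  bind (fun x : void => match x with end) g.

Inductive aconstr (S : signature) : Type :=
| CEq of term S var & term S var
| CPrim (n : nat) of ppred S n & n.-tuple (term S var).

Arguments CEq {S} _ _.
Arguments CPrim {S n} _ _.

Inductive atom (S : signature) : Type :=
| ACon of aconstr S
| ADef (n : nat) of dpred S n & n.-tuple (term S var).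

Arguments ACon {S} _.
Arguments ADef {S n} _ _.

Definition AEq (S : signature) (t s : term S var) : atom S := ACon (CEq t s).
Definition APrim (S : signature) (n : nat) (k : ppred S n)
  (ts : n.-tuple (term S var)) : atom S := ACon (CPrim k ts).

Definition substitution (S : signature) : Type := var -> term S var.

Definition csubst (S : signature) (s : substitution S) (c : aconstr S) :
    aconstr S :=
  match c with
  | CEq t u => CEq (bind s t) (bind s u)
  | CPrim n k ts => CPrim k (map_tuple (bind s) ts)
  end.

Definition asubst (S : signature) (s : substitution S) (A : atom S) : atom S :=
  match A with
  | ACon c => ACon (csubst s c)
  | ADef n p ts => ADef p (map_tuple (bind s) ts)
  end.

Definition aconstr_var (S : signature) (X : var) (c : aconstr S) : Prop :=
  match c with
  | CEq t u => tvar X t \/ tvar X u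
  | CPrim n k ts => exists i, tvar X (tnth ts i)
  end.

Definition atom_var (S : signature) (X : var) (A : atom S) : Prop :=
  match A with
  | ACon c => aconstr_var X c
  | ADef n p ts => exists i, tvar X (tnth ts i)
  end.

(** * Constraints and constraint domains *)

(* First-order formulas over the atomic constraints; the remaining connectives
   and the universal quantifier are (classically) definable. *)
Inductive constr (S : signature) : Type :=
| CAtm of aconstr S
| CTrue
| CAnd of constr S & constr S
| CNot of constr S
| CEx of var & constr S.

Arguments CTrue {S}.

Fixpoint constr_var (S : signature) (X : var) (c : constr S) : Prop :=
  match c with
  | CAtm a => aconstr_var X a
  | CTrue => False
  | CAnd c1 c2 => constr_var X c1 \/ constr_var X c2
  | CNot c1 => constr_var X c1
  | CEx Y c1 => X <> Y /\ constr_var X c1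
  end.

(* [exists U_1 ... exists U_k (B_1 /\ ... /\ B_m)] *)
Definition existential (S : signature) (Us : seq var) (Bs : seq (aconstr S)) :
    constr S :=
  foldr (@CEx S) (foldr (@CAnd S) CTrue (map (@CAtm S) Bs)) Us.

Record cdomain (S : signature) := CDomain {
  interp : forall n, ppred S n -> n.-tuple (gterm S) -> Prop
}.

Definition valuation (S : signature) : Type := var -> gterm S.

Definition upd (S : signature) (eta : valuation S) (X : var) (v : gterm S) :
    valuation S :=
  fun Y => if Y == X then v else eta Y.

Definition asat (S : signature) (C : cdomain S) (eta : valuation S)
    (c : aconstr S) : Prop :=
  match c with
  | CEq t u => bind eta t = bind eta u
  | CPrim n k ts => interp C k (map_tuple (bind eta) ts)
  end.

Fixpoint sat (S : signature) (C : cdomain S) (eta : valuation S)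
    (c : constr S) : Prop :=
  match c with
  | CAtm a => asat C eta a
  | CTrue => True
  | CAnd c1 c2 => sat C eta c1 /\ sat C eta c2
  | CNot c1 => ~ sat C eta c1
  | CEx X c1 => exists v, sat C (upd eta X v) c1
  end.

Definition Sol (S : signature) (C : cdomain S) (Pi : seq (constr S))
    (eta : valuation S) : Prop :=
  forall c, List.In c Pi -> sat C eta c.

Definition satisfiable (S : signature) (C : cdomain S) (Pi : seq (constr S)) :
    Prop :=
  exists eta, Sol C Pi eta.

Definition entails (S : signature) (C : cdomain S) (Pi : seq (constr S))
    (c : aconstr S) : Prop :=
  forall eta, Sol C Pi eta -> asat C eta c.

(* Valuations with a restricted domain.  Whether such a [rho] is a solution is
   meaningful when its domain covers the free variables, in which case all the
   total extensions of [rho] agree. *)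
Definition pvaluation (S : signature) : Type := var -> option (gterm S).

Definition pdom (S : signature) (rho : pvaluation S) (X : var) : Prop :=
  rho X <> None.

Definition extends (S : signature) (eta : valuation S) (rho : pvaluation S) :
    Prop :=
  forall X v, rho X = Some v -> eta X = v.

Definition pSol (S : signature) (C : cdomain S) (Om : seq (constr S))
    (rho : pvaluation S) : Prop :=
  forall eta, extends eta rho -> Sol C Om eta.

Definition psubst (S : signature) (rho : pvaluation S) : substitution S :=
  fun X => if rho X is Some v then of_gterm v else TVar X.

Definition constrs_var (S : signature) (X : var) (Om : seq (constr S)) : Prop :=
  exists2 c, List.In c Om & constr_var X c.

(** * Qualification domains *)

Record qdomain (disp : Order.disp_t) (D : tbLatticeType disp) := QDomain {
  att : D -> D -> D;
  attA : associative att;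
  attC : commutative att;
  att_mono : forall d d' e e', d <= d' -> e <= e' -> att d e <= att d' e';
  att_top : forall d, att d \top = d;
  att_bot : forall d, att d \bot = \bot;
  att_le : forall d e, att d e <= e;
  att_meet : forall d e1 e2, att d (e1 `&` e2) = att d e1 `&` att d e2
}.

Definition nbot (disp : Order.disp_t) (D : tbLatticeType disp) : Type :=
  {d : D | d != \bot}.

(* The embedding is encoded as a total function on [D]; its value at [\bot] is
   irrelevant ([\top] differs from [\bot] once [nbot D] is inhabited). The
   parameters of [qval] and [qbound] are the variables [qvX],
   [qbX], [qbY], [qbZ]. *)
Record expressible (S : signature) (C : cdomain S) (disp : Order.disp_t)
    (D : tbLatticeType disp) (Q : qdomain D) := Expressible {
  qiota : D -> gterm S;
  qiota_inj : {in [pred d | d != \bot] &, injective qiota};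
  qvX : var;
  qvU : seq var;
  qvB : seq (aconstr S);
  qv_uniq : uniq (qvX :: qvU);
  qv_var : forall X B, List.In B qvB -> aconstr_var X B -> X \in qvX :: qvU;
  qv_sol : forall eta,
    sat C eta (existential qvU qvB) <->
    exists2 x, x != \bot & eta qvX = qiota x;
  qbX : var;
  qbY : var;
  qbZ : var;
  qbV : seq var;
  qbC : seq (aconstr S);
  qb_uniq : uniq [:: qbX, qbY, qbZ & qbV];
  qb_var : forall X B, List.In B qbC -> aconstr_var X B ->
    X \in [:: qbX, qbY, qbZ & qbV];
  qb_sol : forall eta x y z, x != \bot -> y != \bot -> z != \bot ->
    eta qbX = qiota x -> eta qbY = qiota y -> eta qbZ = qiota z ->
    (sat C eta (existential qbV qbC) <-> x <= att Q y z)
}.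

(** * Programs and inference systems *)

Record clause (S : signature) := Clause {
  cl_arity : nat;
  cl_pred : dpred S cl_arity;
  cl_args : cl_arity.-tuple (term S var);
  cl_body : seq (atom S)
}.

Arguments Clause {S cl_arity} _ _ _.

(* In a body, [None] is the threshold [?]. *)
Record qclause (S : signature) (disp : Order.disp_t)
    (D : tbLatticeType disp) := QClause {
  qcl_arity : nat;
  qcl_pred : dpred S qcl_arity;
  qcl_args : qcl_arity.-tuple (term S var);
  qcl_att : nbot D;
  qcl_body : seq (atom S * option (nbot D))
}.

Arguments QClause {S disp D qcl_arity} _ _ _ _.

Definition program (S : signature) : Type := clause S -> Prop.

Definition qprogram (S : signature) (disp : Order.disp_t)
  (D : tbLatticeType disp) : Type := qclause S D -> Prop.

Definition meets_threshold (disp : Order.disp_t) (D : tbLatticeType disp)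
    (e : nbot D) (w : option (nbot D)) : Prop :=
  if w is Some v then val v <= val e else True.

(* [chl C P Pi A] is derivability of [A <= Pi] from [P] in CHL(C). *)
Inductive chl (S : signature) (C : cdomain S) (P : program S)
    (Pi : seq (constr S)) : atom S -> Prop :=
| DA (n : nat) (p : dpred S n) (ts' ts : n.-tuple (term S var))
    (Bs : seq (atom S)) (theta : substitution S) :
    P (Clause p ts Bs) ->
    (forall i, chl C P Pi (AEq (tnth ts' i) (bind theta (tnth ts i)))) ->
    (forall j, chl C P Pi (asubst theta (tnth (in_tuple Bs) j))) ->
    chl C P Pi (ADef p ts')
| EA (t s : term S var) :
    entails C Pi (CEq t s) -> chl C P Pi (AEq t s)
| PA (n : nat) (k : ppred S n) (ts : n.-tuple (term S var)) :
    entails C Pi (CPrim k ts) -> chl C P Pi (APrim k ts).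

(* [qchl C Q P Pi A d] is derivability of [A#d <= Pi] from [P] in QCHL(D,C). *)
Inductive qchl (S : signature) (C : cdomain S) (disp : Order.disp_t)
    (D : tbLatticeType disp) (Q : qdomain D) (P : qprogram S D)
    (Pi : seq (constr S)) : atom S -> nbot D -> Prop :=
| QDA (n : nat) (p : dpred S n) (ts' ts : n.-tuple (term S var))
    (alpha : nbot D) (Bs : seq (atom S * option (nbot D)))
    (theta : substitution S) (ds : 'I_n -> nbot D) (es : 'I_(size Bs) -> nbot D) (d : nbot D) :
    P (QClause p ts alpha Bs) ->
    (forall i,
      qchl C Q P Pi (AEq (tnth ts' i) (bind theta (tnth ts i))) (ds i)) ->
    (forall j, qchl C Q P Pi (asubst theta (tnth (in_tuple Bs) j).1) (es j)) ->
    (forall j, meets_threshold (es j) (tnth (in_tuple Bs) j).2) ->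
    val d <= (\meet_(i < n) val (ds i)) `&`
             att Q (val alpha) (\meet_(j < size Bs) val (es j)) ->
    qchl C Q P Pi (ADef p ts') d
| QEA (t s : term S var) (d : nbot D) :
    entails C Pi (CEq t s) -> qchl C Q P Pi (AEq t s) d
| QPA (n : nat) (k : ppred S n) (ts : n.-tuple (term S var)) (d : nbot D) :
    entails C Pi (CPrim k ts) -> qchl C Q P Pi (APrim k ts) d.

(** * The transformation *)

(* The fresh predicate symbols; [primed p] is the symbol p'. *)
Record fresh_preds (S : signature) := FreshPreds {
  qVal : dpred S 1;
  qBound : dpred S 3;
  primed : forall n, dpred S n -> dpred S n.+1;
  primed_inj : forall n, injective (@primed n);
  primed_neq_qVal : forall p : dpred S 0, primed p <> qVal;
  primed_neq_qBound : forall p : dpred S 2, primed p <> qBound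
}.

Section Transformation.
Context (S : signature) (C : cdomain S) (disp : Order.disp_t)
  (D : tbLatticeType disp) (Q : qdomain D) (E : expressible C Q)
  (F : fresh_preds S).

Definition tiota (d : D) : term S var := of_gterm (qiota E d).

Definition aqVal (w : term S var) : atom S := ADef (qVal F) [tuple w].

Definition aqBound (x y z : term S var) : atom S :=
  ADef (qBound F) [tuple x; y; z].

(* Instances of the existential constraints. No renaming of the bound variables
   is performed: [w], resp. [x], [y], [z], must not contain a variable of
   [qvU E], resp. [qbV E]; see [fresh_qcatom]. *)
Definition qval (w : term S var) : constr S :=
  let s X := if X == qvX E then w else TVar X in
  existential (qvU E) (map (csubst s) (qvB E)).

Definition qbound (x y z : term S var) : constr S :=
  let s X := if X == qbX E then x else if X == qbY E then y
             else if X == qbZ E then z else TVar X in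
  existential (qbV E) (map (csubst s) (qbC E)).

Definition E_D : program S := fun K =>
  K = Clause (qVal F) [tuple TVar (qvX E)] (map (@ACon S) (qvB E)) \/
  K = Clause (qBound F) [tuple TVar (qbX E); TVar (qbY E); TVar (qbZ E)]
        (map (@ACon S) (qbC E)).

(* [W] is the variable to be used if [A] is a defined atom. *)
Definition tr_atom (W : var) (A : atom S) : atom S * term S var :=
  match A with
  | ACon c => (ACon c, tiota \top)
  | ADef n p ts => (ADef (primed F p) [tuple of rcons ts (TVar W)], TVar W)
  end.

Definition tr_qcatom (W : var) (A : atom S) (d : nbot D)
    (Pi : seq (constr S)) : (atom S * seq (constr S)) * seq (constr S) :=
  let: (A', w) := tr_atom W A in
  ((A', Pi), [:: qval w; qbound (tiota (val d)) (tiota \top) w]).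

Definition fresh_qcatom (W : var) (A : atom S) (Pi : seq (constr S)) : Prop :=
  [/\ ~ atom_var W A, ~ constrs_var W Pi & W \notin qvU E ++ qbV E].

Definition tr_threshold (w' : term S var) (w : option (nbot D)) :
    seq (atom S) :=
  if w is Some v then [:: aqBound (tiota (val v)) (tiota \top) w'] else [::].

Definition tr_body_atom (W : var) (alpha : nbot D)
    (Bw : atom S * option (nbot D)) (Wj : var) : seq (atom S) :=
  let: (B, w) := Bw in
  let: (B', w') := tr_atom Wj B in
  aqVal w' :: tr_threshold w' w ++
  [:: aqBound (TVar W) (tiota (val alpha)) w'; B'].

(* The rule without this guard leaves [W] unrelated to [alpha] when the body is
   empty: from the fact p <-alpha- it would produce p'(W) <- qVal(W), so that
   p'(iota(\top)) is derivable although only p#d with d <= alpha are. The empty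
   meet being \top, the intended W <= alpha o \top is added in that case. Every
   other clause is transformed by the original rule. *)
Definition fact_guard (W : var) (alpha : nbot D)
    (Bs : seq (atom S * option (nbot D))) : seq (atom S) :=
  if nilp Bs && (val alpha != \top)
  then [:: aqBound (TVar W) (tiota (val alpha)) (tiota \top)] else [::].

Definition tr_clause (W : var) (Ws : seq var) (K : qclause S D) : clause S :=
  let: QClause n p ts alpha Bs := K in
  Clause (primed F p) [tuple of rcons ts (TVar W)]
    (aqVal (TVar W) :: fact_guard W alpha Bs ++
     flatten [seq tr_body_atom W alpha x.1 x.2 | x <- zip Bs Ws]).

Definition qclause_var (X : var) (K : qclause S D) : Prop :=
  (exists i, tvar X (tnth (qcl_args K) i)) \/
  (exists2 B, List.In B (qcl_body K) & atom_var X B.1).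

(* A supply assigns to a clause the variable W of its transformed head and the
   variables available for the transformed body atoms. *)
Definition supply : Type := qclause S D -> var * seq var.

Definition fresh_supply (nu : supply) (P : qprogram S D) : Prop :=
  forall K, P K ->
    [/\ size (nu K).2 = size (qcl_body K),
        uniq ((nu K).1 :: (nu K).2) &
        forall X, X \in (nu K).1 :: (nu K).2 -> ~ qclause_var X K].

Definition elimD (nu : supply) (P : qprogram S D) : program S := fun K' =>
  E_D K' \/ exists2 K, P K & K' = tr_clause (nu K).1 (nu K).2 K.

Definition pred_in_atom (n : nat) (q : dpred S n) (A : atom S) : Prop :=
  exists ts, A = ADef q ts.

Definition pred_in_qclause (n : nat) (q : dpred S n) (K : qclause S D) : Prop :=
  pred_in_atom q (ADef (qcl_pred K) (qcl_args K)) \/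
  exists2 B, List.In B (qcl_body K) & pred_in_atom q B.1.

Definition pred_in_qprogram (n : nat) (q : dpred S n) (P : qprogram S D) :
    Prop :=
  exists2 K, P K & pred_in_qclause q K.

End Transformation.

(* Main.v *)
(** The transformation makes the qualification an extra argument.  A QCHL
    derivation of [p(ts)#d] becomes a CHL derivation of [p'(ts, w)] for every
    [w] that [Pi] equates with the encoding of [d]: in each QDA step the fresh
    variables are instantiated with the encodings of [d] and of the [e_j].
    Conversely, a CHL derivation of [p'(ts, w)] may use non-ground
    qualification arguments, whose values differ from one solution of [Pi] to
    another; fixing an arbitrary solution [eta], the value of [w] under [eta]
    encodes some [x] such that [p(ts)#x] is derivable.  Hence the need for a
    satisfiable [Pi].  If the fresh variable [W] does not occur in [Om], then
    [W] cannot be instantiated by [rho]; but then all ground terms encode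
    [\top], the only element other than [\bot], and [W] needs no
    instantiation. *)
From Stdlib Require List Classical Eqdep_dec PeanoNat.
Require Import Defs.
From mathcomp Require Import all_boot all_order.

Set Implicit Arguments.
Unset Strict Implicit.
Unset Printing Implicit Defensive.

Import Order.LTheory.

(** * Lists and tuples *)

(** Equality of arities is decidable, so dependent pairs over an arity can be inverted without an
    axiom. This underlies every inversion of [ADef] and [Clause]. *)
Lemma existT_nat_inj (T : nat -> Type) n (x y : T n) :
  existT T n x = existT T n y -> x = y.
Proof. exact: (Eqdep_dec.inj_pair2_eq_dec _ PeanoNat.Nat.eq_dec). Qed.

Lemma tnth_In (T : Type) (s : seq T) j : List.In (tnth (in_tuple s) j) s.
Proof.
rewrite (tnth_nth (tnth (in_tuple s) j)) /=; move: (tnth _ j) (ltn_ord j) => x.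
move: (nat_of_ord j) => {j} k.
by elim: s k => [|y s IHs] [|k] //= ltks; [left | right; apply: IHs].
Qed.

Lemma In_tnthP (T : Type) (s : seq T) x :
  List.In x s -> exists j, x = tnth (in_tuple s) j.
Proof.
move=> sx; have [j ltjs ->] : exists2 j, j < size s & x = nth x s j.
  move: sx {2}x; elim: s => //= y s IHs [->|sx] x0; first by exists 0.
  by have [j ltjs ->] := IHs sx x0; exists j.+1.
by exists (Ordinal ltjs); rewrite (tnth_nth x).
Qed.

Lemma In_map (T U : Type) (f : T -> U) s y :
  List.In y (map f s) <-> exists2 x, List.In x s & y = f x.
Proof.
elim: s => [|x s IHs] /=; first by split=> // -[].
rewrite IHs; split=> [[<-|[z sz ->]]|[z [->|sz] ->]].
- by exists x; [left|].
- by exists z; [right|].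
- by left.
- by right; exists z.
Qed.

Lemma In_cat (T : Type) (s1 s2 : seq T) x :
  List.In x (s1 ++ s2) <-> List.In x s1 \/ List.In x s2.
Proof. by elim: s1 => [|y s IHs] /=; [tauto | rewrite IHs; tauto]. Qed.

Lemma In_flatten (T : Type) (ss : seq (seq T)) x :
  List.In x (flatten ss) <-> exists2 s, List.In s ss & List.In x s.
Proof.
elim: ss => [|s ss IHss] /=; first by split=> // -[].
rewrite In_cat IHss; split=> [[sx|[s' ss's' s'x]]|[s' [->|ss's'] s'x]].
- by exists s; [left|].
- by exists s'; [right|].
- by left.
- by right; exists s'.
Qed.

Lemma In_zipP (T U : Type) (y0 : U) (s : seq T) (u : seq U) x :
  size u = size s ->
  List.In x (zip s u) <-> exists j, x = (tnth (in_tuple s) j, nth y0 u j).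
Proof.
move=> eq_su; split=> [|[j ->]].
  move=> sx; have [j ->] := In_tnthP sx; clear x sx.
  have ltj : j < size s by rewrite (leq_trans (ltn_ord j)) // size_zip eq_su minnn.
  exists (Ordinal ltj); case: s u eq_su j ltj => [|a s] [|b u] // eq_su j ltj.
  by rewrite (tnth_nth (a, y0)) (nth_zip _ _ _ (esym eq_su)) (tnth_nth a).
case: s u eq_su j => [|a s] u eq_su j; first by case: j.
have ltj : j < size (zip (a :: s) u) by rewrite size_zip eq_su minnn.
have -> : (tnth (in_tuple (a :: s)) j, nth y0 u j)
          = tnth (in_tuple (zip (a :: s) u)) (Ordinal ltj).
  by rewrite (tnth_nth (a, y0)) (nth_zip _ _ _ (esym eq_su)) (tnth_nth a).
exact: tnth_In.
Qed.

(** A primed atom carries its qualification as an additional last argument. This separates the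
    equation for that argument from those for the original ones. *)
Lemma tnth_rcons_forall (T U : Type) (R : T -> U -> Prop) n
    (ts : n.-tuple T) t (us : n.-tuple U) u :
  (forall i, R (tnth [tuple of rcons ts t] i) (tnth [tuple of rcons us u] i)) <->
  (forall i, R (tnth ts i) (tnth us i)) /\ R t u.
Proof.
have tnthw V (vs : n.-tuple V) v i :
    tnth [tuple of rcons vs v] (widen_ord (leqnSn n) i) = tnth vs i.
  by rewrite !(tnth_nth v) /= nth_rcons size_tuple ltn_ord.
have tnthm V (vs : n.-tuple V) v : tnth [tuple of rcons vs v] ord_max = v.
  by rewrite (tnth_nth v) /= nth_rcons size_tuple ltnn eqxx.
split=> [Rs|[Rs Rtu] i].
  split=> [i|]; first by have := Rs (widen_ord (leqnSn n) i); rewrite !tnthw.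
  by have := Rs ord_max; rewrite !tnthm.
have [ltin|lein] := ltnP i n.
  have -> : i = widen_ord (leqnSn n) (Ordinal ltin) by apply: val_inj.
  by rewrite !tnthw.
have -> : i = ord_max.
  by apply: val_inj; apply/eqP; rewrite eqn_leq lein -ltnS ltn_ord.
by rewrite !tnthm.
Qed.

Lemma map_tuple_rcons (T U : Type) (f : T -> U) n (ts : n.-tuple T) t :
  map_tuple f [tuple of rcons ts t] = [tuple of rcons (map_tuple f ts) (f t)].
Proof. by apply: val_inj; rewrite /= map_rcons. Qed.

Lemma eq_map_tuple (T U : Type) (f g : T -> U) n (ts : n.-tuple T) :
  (forall i, f (tnth ts i) = g (tnth ts i)) -> map_tuple f ts = map_tuple g ts.
Proof. by move=> eq_fg; apply: eq_from_tnth => i; rewrite !tnth_map. Qed.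

(** * Terms and substitutions *)

Section Terms.
Context (S : signature).

(* The automatically generated principle has no hypothesis for the
   arguments of a constructor. *)
Fixpoint term_nested_ind (V : Type) (R : term S V -> Prop)
    (Rvar : forall x, R (TVar x)) (Rbas : forall u, R (TBas u))
    (Rcon : forall n (c : dcon S n) (args : {ffun 'I_n -> term S V}),
       (forall i, R (args i)) -> R (TCon c args))
    (t : term S V) : R t :=
  match t with
  | TVar x => Rvar x
  | TBas u => Rbas u
  | TCon n c args =>
      Rcon n c args (fun i => term_nested_ind Rvar Rbas Rcon (args i))
  end.

Lemma eq_bind (V W : Type) (s s' : V -> term S W) t :
  (forall x, tvar x t -> s x = s' x) -> bind s t = bind s' t.
Proof.
elim/term_nested_ind: t => [x|u|n c args IH] /= eq_s; [exact: eq_s | by [] |].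
congr TCon; apply/ffunP => i; rewrite !ffunE; apply: IH => x x_i.
by apply: eq_s; exists i.
Qed.

Lemma bind_TVar (V : Type) (t : term S V) : bind TVar t = t.
Proof.
elim/term_nested_ind: t => //= n c args IH.
by congr TCon; apply/ffunP => i; rewrite ffunE.
Qed.

Lemma bind_bind (V W X : Type) (s : V -> term S W) (s' : W -> term S X) t :
  bind s' (bind s t) = bind (fun x => bind s' (s x)) t.
Proof.
elim/term_nested_ind: t => //= n c args IH.
by congr TCon; apply/ffunP => i; rewrite !ffunE.
Qed.

Lemma tvar_bind (V W : Type) (s : V -> term S W) t y :
  tvar y (bind s t) <-> exists2 x, tvar x t & tvar y (s x).
Proof.
elim/term_nested_ind: t => [x|u|n c args IH] /=.
- by split=> [|[z ->]]; first by exists x.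
- by split=> // -[].
- split=> [[i]|[x [i x_i] y_x]].
    by rewrite ffunE => /IH[x x_i y_x]; exists x => //; exists i.
  by exists i; rewrite ffunE; apply/IH; exists x.
Qed.

Lemma bind_of_gterm (W : Type) (s : var -> term S W) g :
  bind s (of_gterm g) = bind (fun x : void => match x with end) g.
Proof. by rewrite bind_bind; apply: eq_bind => -[]. Qed.

Lemma eval_of_gterm (eta : valuation S) g : bind eta (of_gterm g) = g.
Proof. by rewrite bind_of_gterm -[RHS]bind_TVar; apply: eq_bind => -[]. Qed.

Lemma tvar_of_gterm g x : ~ tvar x (@of_gterm S g).
Proof. by move=> /tvar_bind[[]]. Qed.

Lemma eq_csubst (s s' : substitution S) c :
  (forall X, aconstr_var X c -> s X = s' X) -> csubst s c = csubst s' c.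
Proof.
case: c => [t u|n k ts] /= eq_s.
  by congr CEq; apply: eq_bind => X tX; apply: eq_s; [left | right].
congr CPrim; apply: eq_map_tuple => i; apply: eq_bind => X tX.
by apply: eq_s; exists i.
Qed.

Lemma csubst_TVar c : csubst (@TVar S var) c = c.
Proof.
case: c => [t u|n k ts] /=; first by rewrite !bind_TVar.
by congr CPrim; apply: eq_from_tnth => i; rewrite tnth_map bind_TVar.
Qed.

Lemma eq_asubst (s s' : substitution S) A :
  (forall X, atom_var X A -> s X = s' X) -> asubst s A = asubst s' A.
Proof.
case: A => [c|n p ts] /= eq_s; first by rewrite (eq_csubst eq_s).
congr ADef; apply: eq_map_tuple => i; apply: eq_bind => X tX.
by apply: eq_s; exists i.
Qed.

Lemma aconstr_var_csubst (s : substitution S) c Y :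
  aconstr_var Y (csubst s c) <-> exists2 X, aconstr_var X c & tvar Y (s X).
Proof.
case: c => [t u|n k ts] /=.
  rewrite !tvar_bind; split=> [[[X tX sX]|[X uX sX]]|[X [tX|uX] sX]].
  - by exists X; first left.
  - by exists X; first right.
  - by left; exists X.
  - by right; exists X.
split=> [[i]|[X [i tX] sX]].
  by rewrite tnth_map => /tvar_bind[X tX sX]; exists X => //; exists i.
by exists i; rewrite tnth_map; apply/tvar_bind; exists X.
Qed.

(** * Satisfaction *)

Context (C : cdomain S).

Lemma eq_asat (eta eta' : valuation S) c :
  (forall X, aconstr_var X c -> eta X = eta' X) ->
  asat C eta c <-> asat C eta' c.
Proof.
case: c => [t u|n k ts] /= eq_eta.
  rewrite (@eq_bind _ _ eta eta' t) => [|X tX]; last by apply: eq_eta; left.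
  by rewrite (@eq_bind _ _ eta eta' u) // => X uX; apply: eq_eta; right.
rewrite (@eq_map_tuple _ _ (bind eta) (bind eta')) // => i.
by apply: eq_bind => X tX; apply: eq_eta; exists i.
Qed.

Lemma asat_csubst (s : substitution S) (eta : valuation S) c :
  asat C eta (csubst s c) <-> asat C (fun X => bind eta (s X)) c.
Proof.
case: c => [t u|n k ts] /=; first by rewrite !bind_bind.
have -> // : map_tuple (bind eta) (map_tuple (bind s) ts) =
             map_tuple (bind (fun X => bind eta (s X))) ts.
by apply: eq_from_tnth => i; rewrite !tnth_map bind_bind.
Qed.

Lemma eq_sat (eta eta' : valuation S) c :
  (forall X, constr_var X c -> eta X = eta' X) -> sat C eta c <-> sat C eta' c.
Proof.
elim: c eta eta' => [a||c1 IH1 c2 IH2|c IH|Y c IH] eta eta' /= eq_eta.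
- exact: eq_asat.
- by [].
- by rewrite (IH1 eta eta') ?(IH2 eta eta') // => X cX; apply: eq_eta; tauto.
- by rewrite (IH eta eta').
- split=> -[v sat_v]; exists v; move: sat_v; apply IH => X cX; rewrite /upd;
  by case: eqP => // neq; rewrite eq_eta.
Qed.

(** Lets a quantifier prefix be handled at once, without iterating [upd]. *)
Lemma sat_existential (eta : valuation S) Us Bs :
  sat C eta (existential Us Bs) <->
  exists2 eta' : valuation S, (forall X, X \notin Us -> eta' X = eta X) &
                              forall B, List.In B Bs -> asat C eta' B.
Proof.
elim: Us eta => [|U Us IH] eta /=.
  transitivity (forall B, List.In B Bs -> asat C eta B).
    rewrite /existential /=; elim: Bs => //= B Bs ->; split=> [[satB satBs] B'|satBs].
      by case=> [<-|/satBs].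
    by split=> [|B' BsB']; apply: satBs; [left | right].
  split=> [satBs|[eta' eq_eta satBs] B BsB]; first by exists eta.
  by apply/(@eq_asat eta eta' B); [move=> X _; rewrite eq_eta | exact: satBs].
split=> [[v /IH[eta' eq_eta satBs]]|[eta' eq_eta satBs]].
  exists eta' => // X; rewrite inE negb_or => /andP[neqXU Us'X].
  by rewrite eq_eta // /upd (negPf neqXU).
exists (eta' U); apply/IH; exists eta' => // X Us'X; rewrite /upd.
by case: eqP => [->|/eqP neqXU] //; rewrite eq_eta // inE negb_or neqXU.
Qed.

Lemma constr_var_existential X Us (Bs : seq (aconstr S)) :
  constr_var X (existential Us Bs) <->
  X \notin Us /\ exists2 B, List.In B Bs & aconstr_var X B.
Proof.
elim: Us => [|U Us IH] /=.
  rewrite /existential /=; elim: Bs => [|B Bs IH] /=.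
    by split=> // -[_ []].
  rewrite IH; split=> [[BX|[_ [B' BsB' B'X]]]|[_ [B' [->|BsB'] B'X]]].
  - by split=> //; exists B; first left.
  - by split=> //; exists B'; first right.
  - by left.
  - by right; split=> //; exists B'.
rewrite IH inE negb_or.
split=> [[/eqP-> [-> //]]|[/andP[/eqP neqXU Us'X] //]].
Qed.

(** The substitution lemma for a quantifier prefix; the two hypotheses say that bound variables are
    fixed and that none is captured. *)
Lemma sat_existential_csubst (s : substitution S) (eta : valuation S) Us Bs :
  (forall X, X \in Us -> s X = TVar X) ->
  (forall X Y, X \notin Us -> tvar Y (s X) -> Y \notin Us) ->
  sat C eta (existential Us (map (csubst s) Bs)) <->
  sat C (fun X => bind eta (s X)) (existential Us Bs).
Proof.
move=> sUs s'Us; rewrite !sat_existential; split=> -[eta' eq_eta satBs].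
  exists (fun X => bind eta' (s X)) => [X Us'X|B BsB].
    by apply: eq_bind => Y sY; apply: eq_eta; apply: s'Us sY.
  by apply/asat_csubst; apply: satBs; apply/In_map; exists B.
(* Outside [Us], [eta'] agrees with the composition of [s] and [eta], but the witness has to agree
   with [eta] itself there. *)
pose eta0 X := if X \in Us then eta' X else eta X.
exists eta0 => [X /negPf Us'X|_ /In_map[B BsB ->]]; first by rewrite /eta0 Us'X.
apply/asat_csubst; apply/(@eq_asat _ eta'); last exact: satBs.
move=> X _; have [UsX|UsX] := boolP (X \in Us).
  by rewrite sUs //= /eta0 UsX.
rewrite eq_eta //; apply: eq_bind => Y sY.
by rewrite /eta0 (negPf (s'Us _ _ UsX sY)).
Qed.

Lemma ADef_inj n (p q : dpred S n) ts us :
  ADef p ts = ADef q us -> p = q /\ ts = us.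
Proof.
case=> ep et; split; first exact: (existT_nat_inj (T := dpred S)).
exact: (existT_nat_inj (T := fun n => n.-tuple (term S var))).
Qed.

Lemma Clause_inj n (p q : dpred S n) ts us Bs Bs' :
  Clause p ts Bs = Clause q us Bs' -> [/\ p = q, ts = us & Bs = Bs'].
Proof.
case=> ep et ->; split=> //; first exact: (existT_nat_inj (T := dpred S)).
exact: (existT_nat_inj (T := fun n => n.-tuple (term S var))).
Qed.

(** * Derivability *)

(** The instance is ground, so its truth under [eta] is its truth under every valuation. This turns
    solutions of [qval] and [qbound] into CHL premises. *)
Lemma entails_ground_csubst Pi (eta : valuation S) c :
  asat C eta c -> entails C Pi (csubst (fun X => of_gterm (eta X)) c).
Proof.
move=> satc eta' _; apply/asat_csubst; apply/(@eq_asat _ eta) => // X _.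
by rewrite eval_of_gterm.
Qed.

Lemma chl_ACon (P : program S) Pi c : chl C P Pi (ACon c) <-> entails C Pi c.
Proof.
split=> [|Pic]; last by case: c Pic => *; [apply: EA | apply: PA].
move e: (ACon c) => A chlA; case: chlA e => //.
- by move=> t s Pits [->].
- by move=> n k ts Pits [->].
Qed.

(** Premises are indexed by membership rather than by position, because the bodies of transformed
    clauses are concatenations. *)
Lemma chl_DA (P : program S) Pi n (p : dpred S n) ts' ts Bs theta :
  P (Clause p ts Bs) ->
  (forall i, entails C Pi (CEq (tnth ts' i) (bind theta (tnth ts i)))) ->
  (forall B, List.In B Bs -> chl C P Pi (asubst theta B)) ->
  chl C P Pi (ADef p ts').
Proof.
move=> PK eq_ts chlBs; apply: DA PK _ _ => [i|j]; first exact/chl_ACon.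
exact/chlBs/tnth_In.
Qed.

Lemma chl_ADef_inv (P : program S) Pi n (p : dpred S n) ts' :
  chl C P Pi (ADef p ts') ->
  exists ts Bs theta, [/\ P (Clause p ts Bs),
    forall i, entails C Pi (CEq (tnth ts' i) (bind theta (tnth ts i))) &
    forall B, List.In B Bs -> chl C P Pi (asubst theta B)].
Proof.
move e: (ADef p ts') => A chlA.
case: chlA e => // m q us' us Bs theta PK eq_us chlBs e.
have [eq_mn _ _] := e; subst m; have [eq_p eq_ts] := ADef_inj e; subst q us'.
exists us, Bs, theta; split=> // [i|B BsB]; first exact/chl_ACon/eq_us.
by have [j ->] := In_tnthP BsB.
Qed.

End Terms.

Local Open Scope order_scope.

Section Elimination.
Context (S : signature) (C : cdomain S) (disp : Order.disp_t)
  (D : tbLatticeType disp) (Q : qdomain D) (E : expressible C Q)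
  (F : fresh_preds S) (P : qprogram S D) (nu : supply S D)
  (Pi : seq (constr S)).
Implicit Types (x y z : D) (w : term S var) (eta : valuation S).

Local Notation elimP := (elimD E F nu P).

(** * The constraints qval and qbound *)

Lemma nbot_top (d : nbot D) : \top != \bot :> D.
Proof. by rewrite -lt0x (lt_le_trans _ (lex1 (val d))) // lt0x (valP d). Qed.

Lemma att1x x : att Q \top x = x.
Proof. by rewrite attC att_top. Qed.

Lemma bind_tiota s x : bind s (tiota E x) = tiota E x.
Proof. exact: bind_of_gterm. Qed.

Lemma eval_tiota eta x : bind eta (tiota E x) = qiota E x.
Proof. exact: eval_of_gterm. Qed.

Lemma sat_qval eta w : (forall Y, tvar Y w -> Y \notin qvU E) ->
  sat C eta (qval E w) <-> exists2 x, x != \bot & bind eta w = qiota E x.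
Proof.
move=> w_U; have /= /andP[XnU _] := qv_uniq E.
rewrite /qval sat_existential_csubst => [|X UX|X Y XnUs].
- by rewrite qv_sol eqxx.
- by case: eqP => // eqX; rewrite -eqX UX in XnU.
- by case: eqP => [_|_ /= ->]; first exact: w_U.
Qed.

Lemma sat_qbound eta tx ty tz x y z :
  (forall Y, tvar Y tx \/ tvar Y ty \/ tvar Y tz -> Y \notin qbV E) ->
  x != \bot -> y != \bot -> z != \bot ->
  bind eta tx = qiota E x -> bind eta ty = qiota E y ->
  bind eta tz = qiota E z ->
  sat C eta (qbound E tx ty tz) <-> x <= att Q y z.
Proof.
move=> t_V x0 y0 z0 etax etay etaz.
have := qb_uniq E; rewrite /= !inE !negb_or.
case/and4P=> /and3P[XY XZ XV] /andP[YZ YV] ZV _.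
rewrite /qbound sat_existential_csubst => [|X VX|X Y XnVs].
- apply: qb_sol => //=; first by rewrite eqxx.
    by rewrite eq_sym (negPf XY) eqxx.
  by rewrite eq_sym (negPf XZ) eq_sym (negPf YZ) eqxx.
- case: eqP => [eqX|_]; first by rewrite -eqX VX in XV.
  case: eqP => [eqX|_]; first by rewrite -eqX VX in YV.
  by case: eqP => [eqX|_] //; rewrite -eqX VX in ZV.
- case: eqP => _; first by move=> ?; apply: t_V; left.
  case: eqP => _; first by move=> ?; apply: t_V; right; left.
  by case: eqP => [_ ?|_ /= -> //]; apply: t_V; right; right.
Qed.

Lemma constr_var_qval w Y : constr_var Y (qval E w) -> tvar Y w.
Proof.
case/constr_var_existential=> YnU [_ /In_map[B qvB_B ->]].
case/aconstr_var_csubst=> X BX; case: eqP => // neqX /= eqY.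
by have := qv_var qvB_B BX; rewrite inE -eqY (negPf YnU) orbF eqY => /eqP.
Qed.

(** The occurrence of [qbZ] in [qbC] is recorded because it does not depend on [tx] and [ty]: it
    transfers from one instance of [qbound] to another. *)
Lemma constr_var_qbound tx ty tz Y : constr_var Y (qbound E tx ty tz) ->
  tvar Y tx \/ tvar Y ty \/
  tvar Y tz /\ exists2 B, List.In B (qbC E) & aconstr_var (qbZ E) B.
Proof.
case/constr_var_existential=> YnV [_ /In_map[B qbC_B ->]].
case/aconstr_var_csubst=> X BX.
case: eqP => [_|neqX]; first by left.
case: eqP => [_|neqY]; first by right; left.
case: eqP => [eqX tzY|neqZ /= eqY].
  by right; right; split=> //; exists B; rewrite // -eqX.
have := qb_var qbC_B BX; rewrite !inE -eqY (negPf YnV) orbF eqY.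
by case/or3P=> /eqP.
Qed.

Lemma constr_var_qboundZ tx ty W : W \notin qbV E ->
  (exists2 B, List.In B (qbC E) & aconstr_var (qbZ E) B) ->
  constr_var W (qbound E tx ty (TVar W)).
Proof.
move=> WnV [B qbC_B BZ]; apply/constr_var_existential; split=> //.
eexists; first by apply/In_map; exists B.
apply/aconstr_var_csubst; exists (qbZ E) => //.
have := qb_uniq E; rewrite /= !inE !negb_or.
case/and4P=> /and3P[XY XZ XV] /andP[YZ YV] ZV _.
by rewrite eq_sym (negPf XZ) eq_sym (negPf YZ) eqxx.
Qed.

(* If [qbZ] is not constrained, then [\top <= att \top z] holds for every [z]
   other than [\bot]; if [qvX] is not, then every ground term encodes some
   such [z]. *)
Lemma constrs_varN_trivial (d : nbot D) W :
  W \notin qvU E ++ qbV E ->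
  ~ constrs_var W [:: qval E (TVar W);
                      qbound E (tiota E (val d)) (tiota E \top) (TVar W)] ->
  forall g, g = qiota E (val d).
Proof.
rewrite mem_cat negb_or => /andP[WnU WnV] OmnW.
have qvalnW : ~ constr_var W (qval E (TVar W)).
  by move=> h; apply: OmnW; eexists; last exact: h; left.
(* The first argument must be freed from the encoding of [d]: an instance with that argument would
   only give [d <= x] below, whereas [\top <= x] is wanted. *)
have qboundnW t (tX : ~ tvar W t) : ~ constr_var W (qbound E t (tiota E \top) (TVar W)).
  move=> /constr_var_qbound h; apply: OmnW.
  exists (qbound E (tiota E (val d)) (tiota E \top) (TVar W)).
    by right; left.
  apply: constr_var_qboundZ => //; case: h => [|[|[_ //]]] /=.
    by move=> /tX.
  by move=> /tvar_of_gterm.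
have nzP (x : D) : x != \bot -> x = \top.
  move=> x0; apply/eqP; rewrite eq_le lex1 /=.
  have V : forall Y, tvar Y (tiota E \top) \/ tvar Y (tiota E \top) \/
                     tvar Y (TVar W : term S var) -> Y \notin qbV E.
    by move=> Y [/tvar_of_gterm|[/tvar_of_gterm|/= ->]].
  have top0 := nbot_top d.
  have satE y : y != \bot ->
      sat C (fun=> qiota E y) (qbound E (tiota E \top) (tiota E \top) (TVar W))
      <-> \top <= att Q \top y.
    by move=> y0; apply: sat_qbound => //; rewrite eval_tiota.
  rewrite -[x in _ <= x]att1x -satE //.
  apply/(@eq_sat _ _ _ (fun=> qiota E \top)); last by rewrite satE ?att1x.
  move=> X cX; have eqX : X = W.
    by case/constr_var_qbound: cX => [/tvar_of_gterm|[/tvar_of_gterm|[]]].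
  by case: (qboundnW (tiota E \top)); [exact: tvar_of_gterm | subst X].
move=> g; have UW Y : tvar Y (TVar W : term S var) -> Y \notin qvU E by move=> /= ->.
have [x x0 /= ->] : exists2 x, x != \bot & bind (fun=> g) (TVar W) = qiota E x.
  apply/sat_qval => //; apply/(@eq_sat _ _ _ (fun=> qiota E (val d))).
    by move=> X cX; have /= eqX := constr_var_qval cX; subst X.
  by apply/sat_qval => //; exists (val d) => //; exact: (valP d).
by rewrite (nzP x x0) (nzP (val d) (valP d)).
Qed.

(** * Derivability of qVal and qBound *)

Lemma asubst_aqVal s w : asubst s (aqVal F w) = aqVal F (bind s w).
Proof. by congr ADef; apply: val_inj. Qed.

Lemma asubst_aqBound s t1 t2 t3 :
  asubst s (aqBound F t1 t2 t3) = aqBound F (bind s t1) (bind s t2) (bind s t3).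
Proof. by congr ADef; apply: val_inj. Qed.

(** A solution of the existential constraint, read as a ground substitution, makes every atom of the
    body of the clause for [qVal] true. *)
Lemma chl_qVal x : x != \bot -> chl C elimP Pi (aqVal F (tiota E x)).
Proof.
move=> x0; have : sat C (fun=> qiota E x) (existential (qvU E) (qvB E)).
  by apply/qv_sol; exists x.
case/sat_existential=> eta eq_eta satB.
apply: (chl_DA (theta := fun X => of_gterm (eta X)) (or_introl (or_introl erefl))).
  move=> i eta' _ /=; rewrite (ord1 i) !(tnth_nth (TVar 0)) /=.
  by rewrite eq_eta //; have /= /andP[] := qv_uniq E.
move=> _ /In_map[B BB ->]; apply/chl_ACon; apply: entails_ground_csubst.
exact: satB.
Qed.

Lemma chl_qBound x y z : x != \bot -> y != \bot -> z != \bot ->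
  x <= att Q y z ->
  chl C elimP Pi (aqBound F (tiota E x) (tiota E y) (tiota E z)).
Proof.
move=> x0 y0 z0 le_xyz; have := qb_uniq E; rewrite /= !inE !negb_or.
case/and4P=> /and3P[XY XZ XV] /andP[YZ YV] ZV _.
(* The three parameters are pairwise distinct, so each gets its own value; the value at all other
   variables is arbitrary. *)
pose eta0 X := if X == qbX E then qiota E x else
               if X == qbY E then qiota E y else qiota E z.
have etaX : eta0 (qbX E) = qiota E x by rewrite /eta0 eqxx.
have etaY : eta0 (qbY E) = qiota E y by rewrite /eta0 eq_sym (negPf XY) eqxx.
have etaZ : eta0 (qbZ E) = qiota E z.
  by rewrite /eta0 eq_sym (negPf XZ) eq_sym (negPf YZ).
have : sat C eta0 (existential (qbV E) (qbC E)).
  by apply/(qb_sol x0 y0 z0 etaX etaY etaZ).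
case/sat_existential=> eta eq_eta satB.
apply: (chl_DA (theta := fun X => of_gterm (eta X)) (or_introl (or_intror erefl))).
  move=> i eta' _ /=; rewrite !(tnth_nth (TVar 0)) /=.
  by case: i => -[|[|[|//]]] /= _; rewrite eq_eta // ?etaX ?etaY ?etaZ.
move=> _ /In_map[B BB ->]; apply/chl_ACon; apply: entails_ground_csubst.
exact: satB.
Qed.

(** The clause for [qBound] has a head of another arity, and primed symbols differ from [qVal], so
    only one clause remains. *)
Lemma elimD_qVal ts Bs : elimP (Clause (qVal F) ts Bs) ->
  ts = [tuple TVar (qvX E)] /\ Bs = map (@ACon S) (qvB E).
Proof.
case=> [[/Clause_inj[] //|//]|[[n p us alpha Bs0] _ e]].
have [eq_n _ _ _] := e; subst n.
by have [/esym/(@primed_neq_qVal _ F)] := Clause_inj e.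
Qed.

Lemma elimD_qBound ts Bs : elimP (Clause (qBound F) ts Bs) ->
  ts = [tuple TVar (qbX E); TVar (qbY E); TVar (qbZ E)] /\
  Bs = map (@ACon S) (qbC E).
Proof.
case=> [[//|/Clause_inj[] //]|[[n p us alpha Bs0] _ e]].
have [eq_n _ _ _] := e; subst n.
by have [/esym/(@primed_neq_qBound _ F)] := Clause_inj e.
Qed.

Lemma elimD_primed n (p : dpred S n) us Bs : elimP (Clause (primed F p) us Bs) ->
  exists ts alpha Bs0, let K := QClause p ts alpha Bs0 in
  let W := (nu K).1 in
  [/\ P K, us = [tuple of rcons ts (TVar W)] &
      Bs = aqVal F (TVar W) :: fact_guard E F W alpha Bs0 ++
           flatten [seq tr_body_atom E F W alpha u.1 u.2 | u <- zip Bs0 (nu K).2]].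
Proof.
case=> [[]e|[[m q ts alpha Bs0] PK e]].
- have [eq_n _ _ _] := e; subst n.
  by have [/(@primed_neq_qVal _ F)] := Clause_inj e.
- have [eq_n _ _ _] := e; subst n.
  by have [/(@primed_neq_qBound _ F)] := Clause_inj e.
- have [eq_n _ _ _] := e; subst m.
  have [/(@primed_inj _ F) eq_p eq_us eq_Bs] := Clause_inj e; subst q.
  by exists ts, alpha, Bs0.
Qed.

(** Composing the substitution of the last DA step with [eta] gives a valuation that solves the
    body, hence the existential constraint. *)
Lemma chl_qVal_inv eta w : Sol C Pi eta -> chl C elimP Pi (aqVal F w) ->
  exists2 x, x != \bot & bind eta w = qiota E x.
Proof.
move=> Pieta /chl_ADef_inv[ts [Bs [theta [/elimD_qVal[-> ->] eq_w chlB]]]].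
have -> : bind eta w = bind eta (theta (qvX E)) := eq_w ord0 _ Pieta.
apply/(qv_sol E (fun X => bind eta (theta X)))/sat_existential.
exists (fun X => bind eta (theta X)) => // B BB.
apply/asat_csubst; have /chl_ACon : chl C elimP Pi (asubst theta (ACon B)).
  by apply: chlB; apply/In_map; exists B.
exact.
Qed.

Lemma chl_qBound_inv eta tx ty tz x y z : Sol C Pi eta ->
  x != \bot -> y != \bot -> z != \bot ->
  bind eta tx = qiota E x -> bind eta ty = qiota E y ->
  bind eta tz = qiota E z ->
  chl C elimP Pi (aqBound F tx ty tz) -> x <= att Q y z.
Proof.
move=> Pieta x0 y0 z0 etax etay etaz.
move=> /chl_ADef_inv[ts [Bs [theta [/elimD_qBound[-> ->] eq_w chlB]]]].
have eqX : bind eta tx = bind eta (theta (qbX E)) := eq_w ord0 _ Pieta.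
have eqY : bind eta ty = bind eta (theta (qbY E)) :=
  eq_w (@Ordinal 3 1 isT) _ Pieta.
have eqZ : bind eta tz = bind eta (theta (qbZ E)) :=
  eq_w (@Ordinal 3 2 isT) _ Pieta.
apply/(qb_sol (e := E) (eta := fun X => bind eta (theta X)) x0 y0 z0);
  rewrite -?eqX -?eqY -?eqZ //.
apply/sat_existential; exists (fun X => bind eta (theta X)) => // B BB.
apply/asat_csubst; have /chl_ACon : chl C elimP Pi (asubst theta (ACon B)).
  by apply: chlB; apply/In_map; exists B.
exact.
Qed.

(** * From QCHL to CHL *)

Lemma qchl_ACon c d : qchl C Q P Pi (ACon c) d <-> entails C Pi c.
Proof.
split=> [|Pic]; last by case: c Pic => *; [apply: QEA | apply: QPA].
move e: (ACon c) => A chlA; case: chlA e => //.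
- by move=> t s d' Pits [->].
- by move=> n k ts d' Pits [->].
Qed.

(** Only the last inference changes: its side condition merely bounds the qualification from
    above. *)
Lemma qchl_le A (d e : nbot D) :
  val d <= val e -> qchl C Q P Pi A e -> qchl C Q P Pi A d.
Proof.
move=> le_de qchlA; case: qchlA le_de.
- move=> n p ts' ts alpha Bs theta ds es e' PK eq_ts qBs thr le_e le_de.
  exact: QDA PK eq_ts qBs thr (le_trans le_de le_e).
- by move=> t s e' Pits _; apply: QEA.
- by move=> n k ts e' Pik _; apply: QPA.
Qed.

Lemma nbot_le (d : nbot D) x : val d <= x -> x != \bot.
Proof. by move=> le_dx; rewrite -lt0x (lt_le_trans _ le_dx) // lt0x (valP d). Qed.

(** Since DA matches heads up to entailed equations, [w] need not be ground. This freedom serves the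
    case in which [W] stays uninstantiated. *)
Lemma qchl_chl A d : fresh_supply nu P -> qchl C Q P Pi A d ->
  match A with
  | ACon c => entails C Pi c
  | ADef n p ts => forall w, entails C Pi (CEq w (tiota E (val d))) ->
      chl C elimP Pi (ADef (primed F p) [tuple of rcons ts w])
  end.
Proof.
move=> freshP; elim=> // n p ts' ts alpha Bs theta ds es {}d PK _ eq_ts _ IHBs.
move=> thr le_d w eq_w; have [] := freshP _ PK.
set K := QClause _ _ _ _ in PK *; set W := (nu K).1; set Ws := (nu K).2.
move=> /= sizeWs /andP[WnWs uniqWs] freshWs.
have top0 := nbot_top d; have d0 := valP d; have a0 := valP alpha.
(* [theta] extended to the fresh variables: [W] encodes [d] and the [j]-th variable of [Ws] encodes
   [es j]. As [Ws] and [Bs] have the same size, [insub] fails exactly on the variables outside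
   [Ws]. *)
pose theta' X := if X == W then tiota E (val d) else
  if insub (index X Ws) is Some j then tiota E (val (es j)) else theta X.
have theta'W : theta' W = tiota E (val d) by rewrite /theta' eqxx.
have theta'Ws (j : 'I_(size Bs)) : theta' (nth W Ws j) = tiota E (val (es j)).
  have ltj : (j < size Ws)%N by rewrite sizeWs.
  rewrite /theta' ifF; first by rewrite index_uniq // valK.
  by apply/negP => /eqP eqW; rewrite -eqW mem_nth in WnWs.
have theta'K X : qclause_var X K -> theta' X = theta X.
  move=> KX; have XnWs : X \notin W :: Ws by apply/negP => /freshWs.
  move: XnWs; rewrite inE negb_or => /andP[/negPf XnW XnWs].
  by rewrite /theta' XnW insubF // memNindex // sizeWs ltnn.
(* Attenuation lies below both of its arguments; this bound is what the guard of a fact asks for. *)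
have le_da : val d <= val alpha.
  apply: le_trans le_d (le_trans (leIr _ _) _).
  by rewrite attC att_le.
have le_dj j : val d <= att Q (val alpha) (val (es j)).
  apply: le_trans le_d (le_trans (leIr _ _) _).
  by apply: att_mono => //; apply: meets_inf.
apply: (chl_DA (theta := theta') (or_intror (ex_intro2 _ _ K PK erefl))).
  apply/(tnth_rcons_forall (fun t u => entails C Pi (CEq t (bind theta' u)))).
  split=> [i|]; last by rewrite /= theta'W.
  rewrite (@eq_bind _ _ _ theta' theta); first exact: eq_ts.
  by move=> X tX; apply: theta'K; left; exists i.
move=> B [<-|/In_cat[|/In_flatten[_ /In_map[y + ->]]]].
- by rewrite asubst_aqVal /= theta'W; apply: chl_qVal.
- rewrite /fact_guard; case: ifP => // _ [<-|//].
  rewrite asubst_aqBound /= theta'W !bind_tiota; apply: chl_qBound => //.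
  by rewrite att_top.
case/(In_zipP W _ sizeWs)=> j -> {y} /=.
have le_dj' := le_dj j; have thr_j := thr j; have IHj := IHBs j.
case eqj: (tnth (in_tuple Bs) j) => [Bj wj]; move: thr_j IHj.
have theta'Bj X : atom_var X Bj -> theta' X = theta X.
  move=> BjX; apply: theta'K; right; exists (Bj, wj) => //.
  by rewrite -eqj; exact: tnth_In.
rewrite eqj /= -(eq_asubst theta'Bj) => thr_j IHj.
(* For a constraint the transformed qualification is [\top], whatever [es j] is. Replacing [es j] by
   a larger [e'] preserves both the threshold and the bound on [d]. *)
have [e' le_e' eq_w'] : exists2 e', val (es j) <= e' &
    bind theta' (tr_atom E F (nth W Ws j) Bj).2 = tiota E e'.
  case: (Bj) => [c|m q us] /=; first by exists \top; rewrite ?lex1 ?bind_tiota.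
  by exists (val (es j)).
have chlBj : chl C elimP Pi (asubst theta' (tr_atom E F (nth W Ws j) Bj).1).
  case: (Bj) IHj => [c|m q us] /= IHj; first by apply/chl_ACon; exact: IHj.
  by rewrite map_tuple_rcons; apply: IHj; rewrite /= theta'Ws.
case: tr_atom eq_w' chlBj => Bj' w' /= eq_w' chlBj.
have e'0 := nbot_le le_e'.
case=> [<-|/In_cat[|[<-|[<-|//]]]].
- by rewrite asubst_aqVal eq_w'; apply: chl_qVal.
- case: wj thr_j {eqj} => [v|] //= le_v [<-|//].
  rewrite asubst_aqBound !bind_tiota eq_w'; apply: chl_qBound => //.
    exact: (valP v).
  by rewrite att1x (le_trans le_v).
- rewrite asubst_aqBound /= theta'W bind_tiota eq_w'; apply: chl_qBound => //.
  by rewrite (le_trans le_dj') // att_mono.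
- exact: chlBj.
Qed.

(** * From CHL to QCHL *)

(** Attenuation distributes over binary meets; the empty meet is [\top], and there the claim is
    [x <= y]. *)
Lemma le_att_meet m x y (es : 'I_m -> D) : x <= y ->
  (forall j, x <= att Q y (es j)) -> x <= att Q y (\meet_(j < m) es j).
Proof.
move=> le_xy le_xes; elim/big_rec: _ => [|j e _ IH]; first by rewrite att_top.
by rewrite att_meet lexI le_xes.
Qed.

(** Only the qualification arguments are evaluated under [eta]. The clauses and substitutions of the
    CHL derivation are kept, and the equations on the original arguments remain entailed by all of
    [Pi]. *)
Lemma chl_qchl n (p : dpred S n) (ts : n.-tuple (term S var)) w eta :
  fresh_supply nu P -> Sol C Pi eta ->
  chl C elimP Pi (ADef (primed F p) [tuple of rcons ts w]) ->
  exists2 x : nbot D, bind eta w = qiota E (val x) &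
                      qchl C Q P Pi (ADef p ts) x.
Proof.
move=> freshP Pieta; move e: (ADef _ _) => A chlA.
elim: chlA n p ts w e => // m q us' us Bs theta PK eq_us _ chlBs IHBs n p ts w e.
have [eq_n _ _] := e; subst m.
have [eq_q eq_us'] := ADef_inj e; subst q us' => {e}.
have [ts0 [alpha [Bs0 [/=]]]] := elimD_primed PK.
set K := QClause _ _ _ _; set W := (nu K).1; set Ws := (nu K).2.
move=> PK0 eq_us0 eq_Bs; subst us.
have [/= sizeWs _ _] := freshP _ PK0.
have {}eq_us : (forall i, entails C Pi (CEq (tnth ts i) (bind theta (tnth ts0 i))))
    /\ entails C Pi (CEq w (bind theta (TVar W))).
  apply/(tnth_rcons_forall (fun t u => entails C Pi (CEq t (bind theta u)))) => i.
  exact/chl_ACon/eq_us.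
case: eq_us => eq_ts /(_ _ Pieta) /= ->.
have {}chlBs B : List.In B Bs -> chl C elimP Pi (asubst theta B).
  by move=> BB; have [j ->] := In_tnthP BB.
have {}IHBs B : List.In B Bs -> forall k (q : dpred S k)
    (vs : k.-tuple (term S var)) v,
    asubst theta B = ADef (primed F q) [tuple of rcons vs v] ->
    exists2 x : nbot D, bind eta v = qiota E (val x) &
                        qchl C Q P Pi (ADef q vs) x.
  move=> BB k q vs v e; have [j eqB] := In_tnthP BB; subst B.
  exact: IHBs (esym e).
(* The premise for [qVal] at [W] makes the value of the head qualification an encoding. *)
have [x x0 eta_W] : exists2 x, x != \bot & bind eta (theta W) = qiota E x.
  apply: chl_qVal_inv => //.
  have := chlBs (aqVal F (TVar W)); rewrite asubst_aqVal /=; apply.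
  by rewrite eq_Bs; left.
rewrite eta_W; pose xn : nbot D := exist _ x x0; exists xn => //.
(* [topn] qualifies the premises that are constraints: the argument equations and the constraint
   atoms of the body. *)
have top0 := nbot_top xn; pose topn : nbot D := exist _ \top top0.
have InBs j B : List.In B (tr_body_atom E F W alpha (tnth (in_tuple Bs0) j) (nth W Ws j)) ->
    List.In B Bs.
  move=> BB; rewrite eq_Bs; right; apply/In_cat; right; apply/In_flatten.
  exists (tr_body_atom E F W alpha (tnth (in_tuple Bs0) j) (nth W Ws j)) => //.
  apply/In_map; exists (tnth (in_tuple Bs0) j, nth W Ws j) => //.
  by apply/(In_zipP W) => //; exists j.
(* The body is finite, so the qualifications of its atoms can be chosen together without a choice
   axiom. The three conditions come from the transformed atom, its threshold and the bound on
   [W]. *)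
have /fin_all_exists[es /all_and3[qBs thr le_x]] (j : 'I_(size Bs0)) :
    exists ej : nbot D,
    [/\ qchl C Q P Pi (asubst theta (tnth (in_tuple Bs0) j).1) ej,
        meets_threshold ej (tnth (in_tuple Bs0) j).2 &
        x <= att Q (val alpha) (val ej)].
  move: (InBs j); case: (tnth (in_tuple Bs0) j) => [Bj wj] /=.
  have [Bj' [w' eq_tr]] : exists Bj' w', tr_atom E F (nth W Ws j) Bj = (Bj', w').
    by do 2 eexists; apply: surjective_pairing.
  rewrite eq_tr => InBsj.
  have [ej eta_w' qBj] : exists2 ej : nbot D,
      bind eta (bind theta w') = qiota E (val ej) &
      qchl C Q P Pi (asubst theta Bj) ej.
    have InBj' : List.In Bj' Bs.
      by apply: InBsj; right; apply/In_cat; right; right; left.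
    case: Bj eq_tr => [c|k q vs] /= [eq_B eq_w]; subst Bj' w'.
      exists topn; first by rewrite bind_tiota eval_tiota.
      by apply/qchl_ACon/chl_ACon/(chlBs _ InBj').
    by apply: (IHBs _ InBj'); rewrite /= map_tuple_rcons.
  exists ej; split=> //.
    case: wj InBsj => //= v InBsj; rewrite -[val ej]att1x.
    have := chlBs (aqBound F (tiota E (val v)) (tiota E \top) w').
    rewrite asubst_aqBound !bind_tiota => chlv.
    apply: (chl_qBound_inv Pieta) (chlv _); rewrite ?eval_tiota ?(valP v) ?(valP ej) //.
    by apply: InBsj; right; left.
  have := chlBs (aqBound F (TVar W) (tiota E (val alpha)) w').
  rewrite asubst_aqBound bind_tiota => chlW.
  apply: (chl_qBound_inv Pieta) (chlW _); rewrite ?eval_tiota ?(valP alpha) ?(valP ej) //.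
  by apply: InBsj; right; apply/In_cat; right; left.
(* Any body atom gives this through its bound on [W]. For a fact with [alpha] other than [\top], it
   is the bound added by [fact_guard]. *)
have le_xa : x <= val alpha.
  have [Bs0_gt0|Bs0_eq0] := ltnP 0 (size Bs0).
    by apply: le_trans (le_x (Ordinal Bs0_gt0)) _; rewrite attC att_le.
  have [-> | alpha_neq1] := eqVneq (val alpha) \top; first exact: lex1.
  have := chlBs (aqBound F (TVar W) (tiota E (val alpha)) (tiota E \top)).
  rewrite asubst_aqBound !bind_tiota -[X in _ <= X](att_top Q) => chlW.
  apply: (chl_qBound_inv Pieta) (chlW _);
    rewrite ?eval_tiota ?(valP alpha) //.
  rewrite eq_Bs; right; apply/In_cat; left.
  by rewrite /fact_guard /nilp -leqn0 Bs0_eq0 alpha_neq1; left.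
apply: (QDA (ds := fun=> topn) PK0 _ qBs thr).
  by move=> i; apply: QEA; apply: eq_ts.
rewrite lexI; apply/andP; split; last exact: le_att_meet.
by apply/meetsP => i _; exact: lex1.
Qed.

End Elimination.

(** * Equivalence of derivability before and after the elimination of qualifications *)

Theorem theorem4p3 (S : signature) (C : cdomain S) (disp : Order.disp_t)
    (D : tbLatticeType disp) (Q : qdomain D) (E : expressible C Q)
    (F : fresh_preds S) (P : qprogram S D) (nu : supply S D)
    (A A' : atom S) (Pi Om : seq (constr S)) (d : nbot D) (W : var) :
  fresh_supply nu P ->
  ~ pred_in_qprogram (qVal F) P -> ~ pred_in_qprogram (qBound F) P ->
  ~ pred_in_atom (qVal F) A -> ~ pred_in_atom (qBound F) A ->
  satisfiable C Pi ->
  fresh_qcatom E W A Pi ->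
  tr_qcatom E F W A d Pi = ((A', Pi), Om) ->
  (qchl C Q P Pi A d <->
   exists rho : pvaluation S,
     [/\ pSol C Om rho,
         (forall X, pdom rho X <-> constrs_var X Om) &
         chl C (elimD E F nu P) Pi (asubst (psubst rho) A')]).
Proof.
move=> freshP _ _ _ _ [eta0 Pieta0] [WnA WnPi WnUV].
have top0 := nbot_top d; have d0 := valP d.
have /andP[WnU WnV] : (W \notin qvU E) && (W \notin qbV E).
  by rewrite -negb_or -mem_cat.
case: A WnA => [c|n p ts] WnA [<- <-].
  (* A constraint is transformed with the ground qualification [\top], so [Om] is closed and [rho]
     has to be empty. *)
  have OmN X : ~ constrs_var X [:: qval E (tiota E \top);
      qbound E (tiota E (val d)) (tiota E \top) (tiota E \top)].
    case=> _ [<-|[<-|//]]; first by move=> /constr_var_qval/tvar_of_gterm.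
    by case/constr_var_qbound=> [|[|[]]] /tvar_of_gterm.
  split=> [/qchl_ACon Pic|[rho [_ domrho chlA]]].
    exists (fun=> None); split.
    - move=> eta _ _ [<-|[<-|//]].
        apply/sat_qval; first by move=> Y /tvar_of_gterm.
        by exists \top; rewrite ?eval_tiota.
      apply/(@sat_qbound _ _ _ _ _ E _ _ _ _ (val d) \top \top) => //;
        rewrite ?eval_tiota //; last by rewrite att1x lex1.
      by move=> Y [|[]] /tvar_of_gterm.
    - by move=> X; split=> [|/OmN].
    - by apply/chl_ACon; rewrite csubst_TVar.
  apply/qchl_ACon; move/chl_ACon: chlA.
  rewrite (@eq_csubst _ _ TVar) ?csubst_TVar // => X _.
  rewrite /psubst; case rhoX: (rho X) => [v|] //.
  by case: (OmN X); apply/domrho; rewrite /pdom rhoX.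
set Om0 := [:: _; _].
have OmW X : constrs_var X Om0 -> X = W.
  case=> _ [<-|[<-|//]]; first by move=> /constr_var_qval.
  by case/constr_var_qbound=> [/tvar_of_gterm|[/tvar_of_gterm|[]]].
have VW Y : tvar Y (tiota E (val d)) \/ tvar Y (tiota E \top) \/
    tvar Y (TVar W : term S var) -> Y \notin qbV E.
  by case=> [/tvar_of_gterm|[/tvar_of_gterm|/= ->]].
have UW Y : tvar Y (TVar W : term S var) -> Y \notin qvU E by move=> /= ->.
have asubstE (rho : pvaluation S) : (forall X, pdom rho X -> X = W) ->
    asubst (psubst rho) (ADef (primed F p) [tuple of rcons ts (TVar W)]) =
    ADef (primed F p) [tuple of rcons ts (psubst rho W)].
  move=> rhoW; rewrite /= map_tuple_rcons; congr ADef; congr [tuple of rcons _ _].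
  apply: eq_from_tnth => i; rewrite tnth_map -[RHS]bind_TVar.
  apply: eq_bind => X tX; rewrite /psubst; case rhoX: (rho X) => [v|] //.
  by case: WnA; exists i; rewrite -(rhoW X) // /pdom rhoX.
split=> [/(qchl_chl E F freshP) chlA|[rho [solrho domrho chlA]]].
  have satOm eta : eta W = qiota E (val d) -> Sol C Om0 eta.
    move=> etaW _ [<-|[<-|//]]; first by apply/sat_qval => //; exists (val d).
    apply/(sat_qbound VW d0 top0 d0); rewrite ?eval_tiota //.
    by rewrite att1x.
  (* The domain of [rho] must be exactly the variables of [Om], so [rho] may instantiate [W] only if
     [W] occurs there. Otherwise every ground term encodes [d], and [TVar W] itself serves as the
     qualification. *)
  have [OmnW|OmnW] := Classical_Prop.classic (constrs_var W Om0).
    pose rho X := if X == W then Some (qiota E (val d)) else None.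
    exists rho; split.
    - by move=> eta ext_eta; apply: satOm; apply: ext_eta; rewrite /rho eqxx.
    - move=> X; rewrite /pdom /rho; case: eqP => [->|neqX] //.
      by split=> // /OmW.
    - rewrite asubstE => [|X]; last by rewrite /pdom /rho; case: eqP.
      by apply: chlA; rewrite /psubst /rho eqxx.
  have trivial := constrs_varN_trivial WnUV OmnW.
  exists (fun=> None); split.
  - by move=> eta _; apply: satOm; apply: trivial.
  - by move=> X; split=> // OmX; case: OmnW; rewrite -(OmW X).
  - rewrite asubstE //; apply: chlA => eta _.
    by rewrite /= eval_tiota; apply: trivial.
(* A valuation extending [rho] that still solves [Pi], because [W] does not occur in [Pi]. *)
pose eta := if rho W is Some v then upd eta0 W v else eta0.
have ext_eta : extends eta rho.
  move=> X v rhoX; have eqX : X = W.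
    by apply: OmW; apply/domrho; rewrite /pdom rhoX.
  by subst X; rewrite /eta rhoX /upd eqxx.
have Pieta : Sol C Pi eta.
  move=> c Pic; apply/(@eq_sat _ _ _ eta0); last exact: Pieta0.
  move=> X cX; rewrite /eta; case: (rho W) => // v; rewrite /upd.
  by case: eqP => // eqX; subst X; case: WnPi; exists c.
rewrite asubstE in chlA; last by move=> X /domrho/OmW.
have [x] := chl_qchl freshP Pieta chlA.
have -> : bind eta (psubst rho W) = eta W.
  rewrite /psubst; case rhoW: (rho W) => [v|] //=.
  by rewrite eval_of_gterm (ext_eta _ _ rhoW).
(* The constraint [qbound] in [Om], evaluated under [eta], says that [d] is below [x], so the
   derivation for [x] can be weakened to [d]. *)
move=> etaW; apply: qchl_le; rewrite -[val x](att1x Q).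
apply/(sat_qbound (eta := eta) VW d0 top0 (valP x)); rewrite ?eval_tiota //.
by apply: (solrho _ ext_eta); right; left.
Qed.
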